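(* Let the system, the box constraint sets $\mathbb{X},\mathbb{U}$, the stage cost $\ell$, the value functions $V_N,V_\infty$ and the MPC feedback laws $\mu_N$ be as in the context. Suppose that there is $\gamma>1$ such that for every $N'\in\mathbb{N}$ and every $x\in\mathbb{X}$, $$V_{N'}(x)\le \gamma\, s^\top x .$$ Suppose that the horizon $N\in\mathbb{N}$ satisfies $$N > 2+\frac{\ln(\gamma-1)}{\ln\gamma-\ln(\gamma-1)} .$$ Then the origin of the MPC closed-loop system $x(t+1)=x(t)+B\mu_N(x(t))$ is globally asymptotically stable on $\mathbb{X}$. In addition, the number $$\alpha_N := 1-\frac{(\gamma-1)^N}{\gamma^{N-1}-(\gamma-1)^{N-1}}$$ lies in $(0,1)$, and for each $x_0\in\mathbb{X}$, $$J^{\mathrm{cl}}_\infty(x_0,\mu_N)\le V_\infty(x_0)/\alpha_N .$$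
   Context: Notation: $\mathbb{N}$ is the set of positive integers, $\mathbb{N}_0=\mathbb{N}\cup\{0\}$, inequalities between vectors are element-wise, and $\mathbf{1}$ is the all-ones vector. System. Consider a directed graph with vertices $\mathcal{V}=\{1,\dots,n\}$ and an additional goal vertex $g=n+1$. Vertex $i\in\mathcal{V}$ has $m_i$ outgoing edges, each leading to a successor vertex $j\in(\mathcal{V}\cup\{g\})\setminus\{i\}$; $m=\sum_i m_i$. The matrix $B=(B_1\ \cdots\ B_n)\in\mathbb{R}^{n\times m}$ has blocks $B_i\in\mathbb{R}^{n\times m_i}$ with one column per outgoing edge of $i$ (ordered by the label of the successor): the column for edge $(i,j)$ with $j\in\mathcal{V}$ has entry $-1$ in row $i$, entry $1$ in row $j$, and zeros elsewhere; the column for edge $(i,g)$ has entry $-1$ in row $i$ and zeros elsewhere. The dynamics are $x(t+1)=x(t)+Bu(t)$ with $x(t)\in\mathbb{R}^n_{\ge0}$, $u(t)\in\mathbb{R}^m_{\ge0}$. Vectors in $\mathbb{R}^m$ are partitioned as $u=(u_1,\dots,u_n)$ with $u_i\in\mathbb{R}^{m_i}$. Constraints. For $x\in\mathbb{R}^n_{\ge0}$ let $U(x)=\{u\in\mathbb{R}^m_{\ge0} : \mathbf{1}^\top u_i\le x_i\ \text{for all } i\in\mathcal{V}\}$. For given bounds $\bar x\in\mathbb{R}^n_{>0}$, $\bar u\in\mathbb{R}^m_{>0}$ let $\mathbb{X}=\{x\in\mathbb{R}^n_{\ge0}: x\le\bar x\}$, $\mathbb{U}=\{u\in\mathbb{R}^m_{\ge0}: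 u\le\bar u\}$, and $\mathbb{U}(x)=U(x)\cap\mathbb{U}$. For a control sequence $u$ (finite or infinite) and initial state $x_0$, $x_u(\cdot,x_0)$ denotes the trajectory $x_u(0,x_0)=x_0$, $x_u(t+1,x_0)=x_u(t,x_0)+Bu(t)$. For $x_0\in\mathbb{X}$ and $N\in\mathbb{N}$, $\mathbb{U}^N(x_0)$ is the set of $u:\{0,\dots,N-1\}\to\mathbb{R}^m_{\ge0}$ such that $x_u(t,x_0)\in\mathbb{X}$ and $u(t)\in\mathbb{U}(x_u(t,x_0))$ for $t=0,\dots,N-1$, and $x_u(N,x_0)\in\mathbb{X}$. $\mathbb{U}^\infty(x_0)$ is the set of $u:\mathbb{N}_0\to\mathbb{R}^m_{\ge0}$ whose restriction to $\{0,\dots,N-1\}$ lies in $\mathbb{U}^N(x_0)$ for every $N\in\mathbb{N}$. Costs. The stage cost is $\ell(x,u)=s^\top x+r^\top u$ with given $s\in\mathbb{R}^n_{>0}$, $r\in\mathbb{R}^m_{\ge0}$. $J_N(x_0,u)=\sum_{t=0}^{N-1}\ell(x_u(t,x_0),u(t))$, $J_\infty(x_0,u)=\lim_{N\to\infty}J_N(x_0,u|_{\{0,\dots,N-1\}})$ (possibly $+\infty$), $V_N(x_0)=\inf\{J_N(x_0,u):u\in\mathbb{U}^N(x_0)\}$, $V_\infty(x_0)=\inf\{J_\infty(x_0,u):u\in\mathbb{U}^\infty(x_0)\}$. It is assumed that for every $x_0\in\mathbb{X}$ and $N\in\mathbb{N}$ there exists an optimal control of length $N$, i.e. some $u\in\mathbb{U}^N(x_0)$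 with $J_N(x_0,u)=V_N(x_0)$. MPC feedback law. For $N\in\mathbb{N}$ and each $x\in\mathbb{X}$, select one optimal control $u^\star\in\mathbb{U}^N(x)$ of length $N$ for $x$ (an arbitrary but fixed selection) and set $\mu_N(x)=u^\star(0)$. For a feedback law $\mu$ on $\mathbb{X}$ keeping $\mathbb{X}$ invariant, $x_\mu(\cdot,x_0)$ is the closed-loop trajectory $x_\mu(0,x_0)=x_0$, $x_\mu(t+1,x_0)=x_\mu(t,x_0)+B\mu(x_\mu(t,x_0))$, and $J^{\mathrm{cl}}_\infty(x_0,\mu)=\lim_{K\to\infty}\sum_{t=0}^{K-1}\ell(x_\mu(t,x_0),\mu(x_\mu(t,x_0)))$. The origin is globally asymptotically stable on $\mathbb{X}$ for the closed loop with $\mu$ if there is a class-$\mathcal{KL}$ function $\beta$ such that $\|x_\mu(t,x_0)\|\le\beta(\|x_0\|,t)$ for all $x_0\in\mathbb{X}$ and $t\in\mathbb{N}_0$. *)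

(* Defs.v *)
From HB Require Import structures.
From mathcomp Require Import all_boot all_order all_algebra.
From mathcomp Require Import all_classical all_reals all_analysis.

Set Implicit Arguments.
Unset Strict Implicit.
Unset Printing Implicit Defensive.

Import Order.TTheory GRing.Theory Num.Theory.
Import numFieldNormedType.Exports.

Local Open Scope classical_set_scope.
Local Open Scope ring_scope.

(* The vertices 1, ..., n are 'I_n, and 'I_n.+1 adds the goal vertex as        *)
(* ord_max; a vertex is embedded in 'I_n.+1 with the same nat value.           *)
(* Only edges that leave a vertex other than the goal are recorded.            *)
Record network (R : realType) := Network {
  nvert : nat;
  edges : {set 'I_nvert * 'I_nvert.+1};
  edges_irr : forall e, e \in edges -> (e.2 : nat) != e.1;
  xbar : 'cV[R]_nvert;
  ubar : 'cV[R]_#|edges|;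
  scost : 'cV[R]_nvert;
  rcost : 'cV[R]_#|edges|;
  xbar_gt0 : forall i, 0 < xbar i 0;
  ubar_gt0 : forall k, 0 < ubar k 0;
  scost_gt0 : forall i, 0 < scost i 0;
  rcost_ge0 : forall k, 0 <= rcost k 0
}.

Section Dynamics.
Context {R : realType} (S : network R).

Definition state := 'cV[R]_(nvert S).
Definition input := 'cV[R]_#|edges S|.

(* enum_val lists the edges in lexicographic order, so the columns of Bmx come *)
(* in one block per tail vertex, each ordered by the label of the head.        *)
Definition tail (k : 'I_#|edges S|) : 'I_(nvert S) := (enum_val k).1.
Definition head (k : 'I_#|edges S|) : 'I_(nvert S).+1 := (enum_val k).2.

Definition Bmx : 'M[R]_(nvert S, #|edges S|) :=
  \matrix_(i, k) (if tail k == i then -1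
                  else if (head k : nat) == i then 1 else 0).

Definition step (x : state) (u : input) : state := x + Bmx *m u.

Definition Uflow (x : state) : set input :=
  [set u | (forall k, 0 <= u k 0) /\
           (forall i, \sum_(k | tail k == i) u k 0 <= x i 0)].

Definition Xbox : set state :=
  [set x | forall i, 0 <= x i 0 <= xbar S i 0].

Definition Ubox : set input :=
  [set u | forall k, 0 <= u k 0 <= ubar S k 0].

Definition Uadm (x : state) : set input := Uflow x `&` Ubox.

(* Control sequences of any length are functions on nat; for length N only     *)
(* the values at 0, ..., N - 1 are constrained and used.                       *)
Fixpoint traj (u : nat -> input) (x0 : state) (t : nat) : state :=
  if t is t'.+1 then step (traj u x0 t') (u t') else x0.

Definition Ufin (N : nat) (x0 : state) : set (nat -> input) :=
  [set u | (forall t, (t < N)%N ->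
              Xbox (traj u x0 t) /\ Uadm (traj u x0 t) (u t)) /\
           Xbox (traj u x0 N)].

Definition Uinf (x0 : state) : set (nat -> input) :=
  [set u | forall N, (0 < N)%N -> Ufin N x0 u].

Definition stage_cost (x : state) (u : input) : R :=
  ((scost S)^T *m x) 0 0 + ((rcost S)^T *m u) 0 0.

Definition Jfin (N : nat) (x0 : state) (u : nat -> input) : R :=
  \sum_(t < N) stage_cost (traj u x0 t) (u t).

Definition Jinf (x0 : state) (u : nat -> input) : \bar R :=
  limn (fun N => (Jfin N x0 u)%:E).

Definition Vfin (N : nat) (x0 : state) : \bar R :=
  ereal_inf [set (Jfin N x0 u)%:E | u in Ufin N x0].

Definition Vinf (x0 : state) : \bar R :=
  ereal_inf [set Jinf x0 u | u in Uinf x0].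

Definition optimal (N : nat) (x0 : state) (u : nat -> input) : Prop :=
  Ufin N x0 u /\ (Jfin N x0 u)%:E = Vfin N x0.

Fixpoint cl_traj (mu : state -> input) (x0 : state) (t : nat) : state :=
  if t is t'.+1 then step (cl_traj mu x0 t') (mu (cl_traj mu x0 t')) else x0.

Definition Jcl (x0 : state) (mu : state -> input) : \bar R :=
  limn (fun K => (\sum_(t < K)
    stage_cost (cl_traj mu x0 t) (mu (cl_traj mu x0 t)))%:E).

End Dynamics.

Section Stability.
Context {R : realType}.

Definition enorm (n : nat) (x : 'cV[R]_n) : R :=
  Num.sqrt (\sum_i x i 0 ^+ 2).

Definition nneg : set R := [set x | 0 <= x].

Definition class_K (f : R -> R) : Prop :=
  [/\ {within nneg, continuous f}, f 0 = 0 &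
      {in nneg &, {homo f : x y / x < y}}].

Definition class_L (f : R -> R) : Prop :=
  [/\ {within nneg, continuous f},
      {in nneg &, {homo f : x y / x < y >-> y < x}} &
      f x @[x --> +oo] --> 0].

(* beta 0 vanishes identically, so decay in t is required only for rho > 0.    *)
Definition class_KL (beta : R -> R -> R) : Prop :=
  [/\ {within nneg `*` nneg, continuous (fun p : R * R => beta p.1 p.2)},
      forall t, 0 <= t -> class_K (beta ^~ t) &
      forall rho, 0 < rho -> class_L (beta rho)].

(* The norm is Euclidean; as all norms on R^n are equivalent, another choice   *)
(* gives the same notion.                                                      *)
Definition gas (S : network R) (mu : state S -> input S) : Prop :=
  exists2 beta : R -> R -> R, class_KL beta &
    forall x0, Xbox x0 -> forall t : nat,
      enorm (cl_traj mu x0 t) <= beta (enorm x0) t%:R.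

End Stability.

Definition alphaN {R : realType} (gamma : R) (N : nat) : R :=
  1 - (gamma - 1) ^+ N / (gamma ^+ N.-1 - (gamma - 1) ^+ N.-1).

(* Main.v *)
Require Import Defs.
From mathcomp Require Import all_boot all_order all_algebra.
From mathcomp Require Import all_classical all_reals all_analysis.
From mathcomp Require Import lra.

Set Implicit Arguments.
Unset Strict Implicit.
Unset Printing Implicit Defensive.

Import Order.TTheory GRing.Theory Num.Theory.
Import numFieldNormedType.Exports.

Local Open Scope classical_set_scope.
Local Open Scope ring_scope.

(** Write [l] for the stage cost, [V] for the optimal cost over [N] steps and
    [mu] for the feedback. Since [s^T x] is the least stage cost at [x], the
    hypothesis compares optimal costs of every length with the cost of a single
    step. The heart of the proof is the relaxed dynamic programming inequality
      [V (x + B mu(x)) <= V x - alphaN * l (x, mu(x))]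
    ([relaxed_Lyapunov_decrease]). To get it, let [y] be the successor of [x],
    and compare [V y] with the cost [T] of the last [N - 1] steps of the optimal
    control from [x], which all take place after [y] has been reached. For each
    [i < N - 1], one may follow this tail for [i] steps and then switch to an
    optimal control for the remaining horizon, which costs at most [gamma]
    times the stage cost [a i] of the tail at that time; hence
      [V y - \sum_(k < i) a k <= gamma * a i].
    So each summand eats at least the fraction [1 / gamma] of what is missing to
    [V y], and the gap shrinks geometrically ([deficit_geometric_decay],
    [optimal_cost_deficit]):
      [V y - T <= ((gamma - 1) / gamma)^(N - 1) * V y].
    On the other hand [V x = l (x, mu(x)) + T <= gamma * l (x, mu(x))], so that
    [T <= (gamma - 1) * l (x, mu(x))]. Eliminating [T] gives the inequality with
    exactly the constant [alphaN], and the bound on the horizon is [alphaN > 0]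
    after taking logarithms.

    Summing the inequality along the closed loop telescopes to
    [alphaN * Jcl <= V x0], and [V x0 <= Vinf x0] as stage costs are
    nonnegative. For stability, [s^T x <= V x <= gamma * s^T x] turns the
    decrease of [V] into a contraction by the factor [1 - alphaN / gamma] in
    each step; as [s > 0], on nonnegative states [s^T x] is equivalent to the
    norm, and the closed loop decays exponentially ([scost_cl_traj_le], [gas_of_exponential_bound]). *)

(** * The horizon bound and the performance index *)

(** The quotient of logarithms exceeds [-1], since
    [1 + ln (gamma - 1) / (ln gamma - ln (gamma - 1))] equals
    [ln gamma / (ln gamma - ln (gamma - 1))]. So the bound forces [1 < N] and
    reads [gamma * (gamma - 1) ^+ N.-1 < gamma ^+ N.-1] after exponentiation. *)
Lemma geometric_gap_of_horizon (R : realType) (gamma : R) (N : nat) :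
  1 < gamma -> 2 + ln (gamma - 1) / (ln gamma - ln (gamma - 1)) < N%:R ->
  (gamma - 1) ^+ N < gamma ^+ N.-1 - (gamma - 1) ^+ N.-1.
Proof.
move=> g1.
have g0 : 0 < gamma by lra.
have p0 : 0 < gamma - 1 by lra.
have lnlt : ln (gamma - 1) < ln gamma by rewrite ltr_ln ?posrE//; lra.
have lng : 0 < ln gamma by rewrite ln_gt0.
have d0 : 0 < ln gamma - ln (gamma - 1) by rewrite subr_gt0.
case: N => [|M] hN.
  suff : -1 < ln (gamma - 1) / (ln gamma - ln (gamma - 1)) by lra.
  by rewrite ltr_pdivlMr//; lra.
have {}hN : ln gamma + ln (gamma - 1) *+ M < ln gamma *+ M.
  have : 1 + ln (gamma - 1) / (ln gamma - ln (gamma - 1)) < M%:R.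
    by move: hN; rewrite -(natr1 M); lra.
  rewrite -ltrBrDl ltr_pdivrMr// -[ln gamma *+ M]mulr_natl.
  by rewrite -[ln (gamma - 1) *+ M]mulr_natl; lra.
rewrite -!lnXn// -lnM ?posrE ?exprn_gt0// in hN.
rewrite ltr_ln ?posrE ?mulr_gt0 ?exprn_gt0// in hN.
by rewrite exprS /=; lra.
Qed.

Lemma alphaN_itv (R : realType) (gamma : R) (N : nat) :
  1 < gamma -> (gamma - 1) ^+ N < gamma ^+ N.-1 - (gamma - 1) ^+ N.-1 ->
  0 < alphaN gamma N < 1.
Proof.
move=> g1 gap.
have p0 : 0 < (gamma - 1) ^+ N by rewrite exprn_gt0//; lra.
have d0 := lt_trans p0 gap.
by rewrite /alphaN subr_gt0 ltr_pdivrMr// mul1r gap gtrBl divr_gt0.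
Qed.

(** The hypothesis says that [a i] is at least the fraction [1 / gamma] of the
    deficit [v - \sum_(k < i) a k], so that subtracting [a i] multiplies the
    deficit by at most [(gamma - 1) / gamma]. *)
Lemma deficit_geometric_decay (R : realType) (gamma v : R) (a : nat -> R)
    (M : nat) :
  1 < gamma ->
  (forall i, (i < M)%N -> v <= \sum_(k < i) a k + gamma * a i) ->
  (v - \sum_(k < M) a k) * gamma ^+ M <= (gamma - 1) ^+ M * v.
Proof.
move=> g1; have p0 : 0 <= gamma - 1 by lra.
elim: M => [|M IH] h; first by rewrite big_ord0 !expr0; lra.
have {IH} IH := IH (fun i iM => h i (ltnW iM)).
have {h} h := h M (ltnSn M).
rewrite big_ord_recr/= !exprS.
move: IH h; set s := \sum_(_ < _) _ => IH h.
have gM : 0 <= gamma ^+ M by rewrite exprn_ge0//; lra.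
have IH' := ler_wpM2l p0 IH; rewrite mulrA in IH'.
have h' : 0 <= (s + gamma * a M - v) * gamma ^+ M by rewrite mulr_ge0//; lra.
by move: IH' h'; lra.
Qed.

(** * Trajectories, costs and value functions *)

Section Network.
Context {R : realType} (S : network R).
Implicit Types (x y : state S) (u v : nat -> input S) (mu : state S -> input S).

Local Notation scost_of x := (((scost S)^T *m x) 0 0).

Definition shift u k : nat -> input S := fun t => u (k + t)%N.

Definition splice k u v : nat -> input S :=
  fun t => if (t < k)%N then u t else v (t - k)%N.

Lemma traj_shift u x k t : traj (shift u k) (traj u x k) t = traj u x (k + t).
Proof. by elim: t => [|t IH]; rewrite ?addn0// addnS /= IH. Qed.

Lemma traj_splice_le k u v x t : (t <= k)%N ->
  traj (splice k u v) x t = traj u x t.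
Proof. by elim: t => [//|t IH] tk /=; rewrite IH 1?ltnW// /splice tk. Qed.

Lemma traj_splice_addn k u v x t :
  traj (splice k u v) x (k + t) = traj v (traj u x k) t.
Proof.
elim: t => [|t IH]; first by rewrite addn0 traj_splice_le.
by rewrite addnS /= IH /splice ltnNge leq_addr /= addKn.
Qed.

Lemma Ufin_splice k m u v x : Ufin k x u -> Ufin m (traj u x k) v ->
  Ufin (k + m) x (splice k u v).
Proof.
move=> [uk _] [vm vX]; split; last by rewrite traj_splice_addn.
move=> t tkm; case: (ltnP t k) => tk.
  by rewrite traj_splice_le 1?ltnW// /splice tk; exact: uk.
rewrite -(subnKC tk) traj_splice_addn /splice ltnNge leq_addr /= addKn.
by apply: vm; rewrite ltn_subLR.
Qed.

Lemma Ufin_take k m u x : Ufin (k + m) x u -> Ufin k x u.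
Proof.
move=> [h hX]; split=> [t tk|]; first by apply: h; rewrite ltn_addr.
case: m h hX => [|m] h hX; first by rewrite addn0 in hX.
by have [] := h k; rewrite // addnS ltnS leq_addr.
Qed.

Lemma Ufin_drop k m u x : Ufin (k + m) x u -> Ufin m (traj u x k) (shift u k).
Proof.
move=> [h hX]; split=> [t tm|]; rewrite traj_shift//.
by apply: h; rewrite ltn_add2l.
Qed.

Lemma Jfin_splice k m u v x :
  Jfin (k + m) x (splice k u v) = Jfin k x u + Jfin m (traj u x k) v.
Proof.
rewrite /Jfin big_split_ord /=; congr (_ + _); apply: eq_bigr => i _.
  by rewrite traj_splice_le 1?ltnW// /splice ltn_ord.
by rewrite traj_splice_addn /splice ltnNge leq_addr /= addKn.
Qed.

Lemma Jfin_succ m u x :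
  Jfin m.+1 x u = stage_cost x (u 0%N) + Jfin m (step x (u 0%N)) (shift u 1).
Proof.
rewrite /Jfin big_ord_recl /=; congr (_ + _); apply: eq_bigr => i _.
by rewrite -[step x _]/(traj u x 1) traj_shift.
Qed.

Lemma scost_sum x : scost_of x = \sum_i scost S i 0 * x i 0.
Proof. by rewrite mxE; apply: eq_bigr => i _; rewrite mxE. Qed.

Lemma scost_le_stage_cost x (w : input S) : (forall k, 0 <= w k 0) ->
  scost_of x <= stage_cost x w.
Proof.
move=> w0; rewrite /stage_cost lerDl mxE sumr_ge0// => k _.
by rewrite mxE mulr_ge0// rcost_ge0.
Qed.

Lemma scost_ge0 x : Xbox x -> 0 <= scost_of x.
Proof.
move=> xX; rewrite scost_sum sumr_ge0// => i _.
by rewrite mulr_ge0 ?(ltW (scost_gt0 _))//; have /andP[] := xX i.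
Qed.

Lemma stage_cost_ge0 x (w : input S) : Xbox x -> (forall k, 0 <= w k 0) ->
  0 <= stage_cost x w.
Proof.
by move=> xX w0; rewrite (le_trans (scost_ge0 xX))// scost_le_stage_cost.
Qed.

Lemma Ufin_input_ge0 N x u t : Ufin N x u -> (t < N)%N -> forall k, 0 <= u t k 0.
Proof. by move=> [h _] tN; have [_ [[]]] := h t tN. Qed.

Lemma Jfin_ge0 N x u : Ufin N x u -> 0 <= Jfin N x u.
Proof.
move=> hu; apply: sumr_ge0 => i _; apply: stage_cost_ge0.
  by case: hu => h _; have [] := h i (ltn_ord i).
exact: Ufin_input_ge0 hu (ltn_ord i).
Qed.

Lemma optimal_le N x u v : optimal N x u -> Ufin N x v ->
  Jfin N x u <= Jfin N x v.
Proof.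
move=> [_ uV] hv; rewrite -lee_fin uV; apply: ereal_inf_lbound.
by exists v.
Qed.

Lemma Jfin_le_Jinf N x u : Uinf x u -> ((Jfin N x u)%:E <= Jinf x u)%E.
Proof.
move=> hu.
have nd : {homo (fun n => (Jfin n x u)%:E) : n m / (n <= m)%N >-> (n <= m)%E}.
  apply/nondecreasing_seqP => n; rewrite lee_fin /Jfin big_ord_recr/= lerDl.
  have [h _] := hu n.+1 isT; have [xX _] := h n (ltnSn n).
  apply: stage_cost_ge0 xX _; exact: Ufin_input_ge0 (hu n.+1 isT) (ltnSn n).
apply: lime_ge; first exact: ereal_nondecreasing_is_cvgn.
by exists N => // n /= Nn; exact: nd.
Qed.

Lemma optimal_le_Vinf N x u : (0 < N)%N -> optimal N x u ->
  ((Jfin N x u)%:E <= Vinf x)%E.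
Proof.
move=> N0 hu; apply: le_ereal_inf_tmp => _ [v hv <-].
by rewrite (le_trans _ (Jfin_le_Jinf N hv))// lee_fin (optimal_le hu)//; exact: hv.
Qed.

(** * Relaxed dynamic programming *)

(** The deficits of the partial costs of [v] shrink geometrically because after
    [i] steps along [v] the horizon that remains can be filled with an optimal
    control, whose cost is at most [gamma] times the cheapest stage cost at the
    point reached, hence at most [gamma] times the stage cost of [v] there. *)
Lemma optimal_cost_deficit (gamma : R) (N M : nat) y w v :
  1 < gamma ->
  (forall x n, Xbox x -> (0 < n)%N -> exists u, optimal n x u) ->
  (forall n x, (0 < n)%N -> Xbox x -> (Vfin n x <= (gamma * scost_of x)%:E)%E) ->
  (M <= N)%N -> optimal N y w -> Ufin M y v ->
  (Jfin N y w - Jfin M y v) * gamma ^+ M <= (gamma - 1) ^+ M * Jfin N y w.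
Proof.
move=> g1 hopt hV MN hw hv.
apply: (deficit_geometric_decay
  (a := fun t => stage_cost (traj v y t) (v t))) => // i iM.
have iN : (i <= N)%N := ltnW (leq_trans iM MN).
have [h _] := hv; have [xiX _] := h i iM.
have Ni0 : (0 < N - i)%N by rewrite subn_gt0 (leq_trans iM MN).
have [z hz] := hopt _ _ xiX Ni0.
have hvi : Ufin i y v by apply: (@Ufin_take i (M - i) _ _); rewrite subnKC// ltnW.
have := Ufin_splice hvi hz.1; rewrite subnKC// => hs.
apply: le_trans (optimal_le hw hs) _.
rewrite -{1}(subnKC iN) Jfin_splice lerD2l.
have : Jfin (N - i) (traj v y i) z <= gamma * scost_of (traj v y i).
  by rewrite -lee_fin hz.2 hV.
move/le_trans; apply; rewrite ler_pM2l ?(lt_trans ltr01 g1)//.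
exact: scost_le_stage_cost (Ufin_input_ge0 hv iM).
Qed.

(** Let [T] be the cost of the optimal control [u] after its first step, whose
    cost is [l]. The previous lemma bounds the optimal cost [nu] at the
    successor by [T] up to the factor
    [gamma ^+ N.-1 / (gamma ^+ N.-1 - (gamma - 1) ^+ N.-1)], and
    [l + T <= gamma * l] bounds [T] by [(gamma - 1) * l]. *)
Lemma relaxed_Lyapunov_decrease (gamma : R) (N : nat) x u w :
  1 < gamma ->
  (forall x n, Xbox x -> (0 < n)%N -> exists u, optimal n x u) ->
  (forall n x, (0 < n)%N -> Xbox x -> (Vfin n x <= (gamma * scost_of x)%:E)%E) ->
  (0 < N)%N -> (gamma - 1) ^+ N < gamma ^+ N.-1 - (gamma - 1) ^+ N.-1 ->
  Xbox x -> optimal N x u -> optimal N (step x (u 0%N)) w ->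
  Jfin N (step x (u 0%N)) w
    <= Jfin N x u - alphaN gamma N * stage_cost x (u 0%N).
Proof.
move=> g1 hopt hV; case: N => // M _ gap xX hu hw.
have hv : Ufin M (step x (u 0%N)) (shift u 1) := @Ufin_drop 1 M u x hu.1.
have decay := optimal_cost_deficit g1 hopt hV (leqnSn M) hw hv.
have tail_le : Jfin M (step x (u 0%N)) (shift u 1)
    <= (gamma - 1) * stage_cost x (u 0%N).
  have : Jfin M.+1 x u <= gamma * stage_cost x (u 0%N).
    apply: (@le_trans _ _ (gamma * scost_of x)).
      by rewrite -lee_fin hu.2 hV.
    rewrite ler_pM2l ?(lt_trans ltr01 g1)//.
    exact: scost_le_stage_cost (Ufin_input_ge0 hu.1 (ltn0Sn M)).
  by rewrite Jfin_succ; lra.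
rewrite [Jfin _ x u]Jfin_succ /alphaN /=; move: decay tail_le gap => /=.
set nu := Jfin M.+1 _ w; set T := Jfin M _ _; set l := stage_cost _ _.
rewrite [(gamma - 1) ^+ M.+1]exprS; set p := (gamma - 1) ^+ M; set q := gamma ^+ M.
move=> decay tail_le gap.
have p0 : 0 < p by rewrite exprn_gt0//; lra.
have d0 : 0 < q - p by apply: lt_trans gap; rewrite mulr_gt0//; lra.
suff : nu - T <= (gamma - 1) * p / (q - p) * l by lra.
rewrite mulrAC ler_pdivlMr//.
have := ler_wpM2l (ltW p0) tail_le; lra.
Qed.

(** * Consequences for the closed loop *)

(** [W] stands for the optimal cost over the horizon; only the comparison with
    [s^T x] and the relaxed decrease matter from here on. *)
Section ClosedLoop.
Variables (mu : state S -> input S) (W : state S -> R) (alpha gamma : R).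
Hypotheses (alpha01 : 0 < alpha < 1) (gamma1 : 1 < gamma).
Hypothesis step_Xbox : forall x, Xbox x -> Xbox (step x (mu x)).
Hypothesis mu_ge0 : forall x, Xbox x -> forall k, 0 <= mu x k 0.
Hypothesis W_lb : forall x, Xbox x -> scost_of x <= W x.
Hypothesis W_ub : forall x, Xbox x -> W x <= gamma * scost_of x.
Hypothesis W_step : forall x, Xbox x ->
  W (step x (mu x)) <= W x - alpha * stage_cost x (mu x).

Lemma cl_traj_Xbox x t : Xbox x -> Xbox (cl_traj mu x t).
Proof. by move=> xX; elim: t => //= t IH; exact: step_Xbox. Qed.

Lemma Jcl_le x : Xbox x -> (Jcl x mu <= (W x / alpha)%:E)%E.
Proof.
move=> xX; have /andP[a0 _] := alpha01.
apply: lime_le.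
  apply: ereal_nondecreasing_is_cvgn; apply/nondecreasing_seqP => n.
  rewrite lee_fin big_ord_recr/= lerDl.
  by apply: stage_cost_ge0; [|apply: mu_ge0]; exact: cl_traj_Xbox.
apply: nearW => K; rewrite lee_fin ler_pdivlMr//.
have W0 : 0 <= W (cl_traj mu x K).
  have := cl_traj_Xbox K xX => yX.
  exact: le_trans (scost_ge0 yX) (W_lb yX).
(* The term [W] at time [K] makes the sum telescope under induction. *)
suff : (\sum_(t < K) stage_cost (cl_traj mu x t) (mu (cl_traj mu x t))) * alpha
    + W (cl_traj mu x K) <= W x by lra.
elim: {W0} K => [|K IH]; first by rewrite big_ord0 mul0r add0r.
apply: le_trans IH; rewrite big_ord_recr/=.
by have := W_step (cl_traj_Xbox K xX); lra.
Qed.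

(** The decrease of [W] in a step is at least [alpha * s^T x], hence at least
    [alpha / gamma * W x]: [W] contracts by the factor [1 - alpha / gamma]. *)
Lemma scost_cl_traj_le x t : Xbox x ->
  scost_of (cl_traj mu x t) <= gamma * (1 - alpha / gamma) ^+ t * scost_of x.
Proof.
move=> xX; have /andP[a0 a1] := alpha01.
have g0 : 0 < gamma by rewrite (lt_trans ltr01).
have k0 : 0 <= 1 - alpha / gamma.
  by rewrite subr_ge0 ler_pdivrMr// mul1r ltW// (lt_trans a1).
apply: le_trans (W_lb (cl_traj_Xbox t xX)) _.
suff : W (cl_traj mu x t) <= (1 - alpha / gamma) ^+ t * W x.
  by move/le_trans; apply; rewrite mulrAC mulrC ler_wpM2r ?exprn_ge0// W_ub.
elim: t => [|t IH]; first by rewrite expr0 mul1r.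
rewrite /=; have yX := cl_traj_Xbox t xX.
apply: le_trans (W_step yX) _.
apply: (@le_trans _ _ ((1 - alpha / gamma) * W (cl_traj mu x t))); last first.
  by rewrite exprS -mulrA ler_wpM2l.
rewrite mulrBl mul1r lerD2l lerN2 -mulrA ler_pM2l// mulrC ler_pdivrMr// mulrC.
apply: le_trans (W_ub yX) _; rewrite ler_pM2l//.
exact: scost_le_stage_cost (mu_ge0 yX).
Qed.

End ClosedLoop.

Lemma enorm_le_scost x : Xbox x ->
  enorm x <= (\sum_i (scost S i 0)^-1) * scost_of x.
Proof.
move=> xX; have x0 i : 0 <= x i 0 by have /andP[] := xX i.
have term0 i : 0 <= scost S i 0 * x i 0 by rewrite mulr_ge0// ltW// scost_gt0.
apply: (@le_trans _ _ (\sum_i x i 0)).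
  rewrite -[leRHS]ger0_norm ?sumr_ge0// -sqrtr_sqr ler_sqrt ?sqr_ge0//.
  rewrite expr2 mulr_suml ler_sum// => i _.
  by rewrite expr2 ler_wpM2l// (bigD1 i)//= lerDl sumr_ge0.
rewrite mulr_suml ler_sum// => i _.
rewrite scost_sum mulrC ler_pdivlMr ?scost_gt0// mulrC.
by rewrite (bigD1 i)//= lerDl sumr_ge0.
Qed.

Lemma scost_le_enorm x : Xbox x -> scost_of x <= (\sum_i scost S i 0) * enorm x.
Proof.
move=> xX; rewrite scost_sum mulr_suml ler_sum// => i _.
rewrite ler_wpM2l ?(ltW (scost_gt0 _))//.
have x0 : 0 <= x i 0 by have /andP[] := xX i.
rewrite -[leLHS]ger0_norm// -sqrtr_sqr ler_wsqrtr//.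
by rewrite (bigD1 i)//= lerDl sumr_ge0// => j _; exact: sqr_ge0.
Qed.

End Network.

Lemma class_KL_exponential (R : realType) (C a : R) : 0 < C -> 0 < a ->
  class_KL (fun r t => C * r * expR (- (a * t))).
Proof.
move=> C0 a0.
have cont : continuous (fun p : R * R => C * p.1 * expR (- (a * p.2))).
  move=> p; apply: cvgM.
    by apply: cvgM; [exact: cvg_cst|exact: cvg_fst].
  apply: (continuous_comp (f := fun p : R * R => - (a * p.2)) (g := expR)).
    by apply: cvgN; apply: cvgM; [exact: cvg_cst|exact: cvg_snd].
  exact: continuous_expR.
split=> [|t t0|r r0].
- exact: continuous_subspaceT.
- split.
  + apply: continuous_subspaceT => r.
    apply: cvgM; last exact: cvg_cst.
    by apply: cvgM; [exact: cvg_cst|exact: cvg_id].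
  + by rewrite mulr0 mul0r.
  + by move=> r s _ _ rs; rewrite ltr_pM2r ?expR_gt0// ltr_pM2l.
- split.
  + apply: continuous_subspaceT => t.
    apply: cvgM; first exact: cvg_cst.
    apply: (continuous_comp (f := fun t : R => - (a * t)) (g := expR)).
      by apply: cvgN; apply: cvgM; [exact: cvg_cst|exact: cvg_id].
    exact: continuous_expR.
  + move=> t s _ _ ts; rewrite ltr_pM2l ?mulr_gt0// ltr_expR ltrN2.
    by rewrite ltr_pM2l.
  + rewrite -[X in _ --> X](mulr0 (C * r)).
    apply: cvgM; first exact: cvg_cst.
    apply: (@cvg_comp _ _ _ (fun t => a * t) (fun y => expR (- y)) _ +oo).
      by apply: gt0_cvgMry => //; exact: cvg_id.
    exact: cvgr_expR.
Qed.

(** The geometric rate is interpolated to real times by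
    [expR (ln kappa * t)]. *)
Lemma gas_of_exponential_bound (R : realType) (S : network R)
    (mu : state S -> input S) (C kappa : R) : 0 < C -> 0 < kappa < 1 ->
  (forall x t, Xbox x -> enorm (cl_traj mu x t) <= C * enorm x * kappa ^+ t) ->
  gas mu.
Proof.
move=> C0 /[dup] k01 /andP[k0 _] h.
exists (fun r t => C * r * expR (- (- ln kappa * t))).
  by apply: class_KL_exponential => //; rewrite oppr_gt0 ln_lt0.
by move=> x xX t; rewrite mulNr opprK expRM_natr lnK ?posrE//; exact: h.
Qed.

Theorem theorem2 (R : realType) (S : network R)
  (hopt : forall (x0 : state S) (N' : nat), Xbox x0 -> (0 < N')%N ->
     exists u : nat -> input S, optimal N' x0 u)
  (gamma : R) (hgamma : 1 < gamma)
  (hV : forall (N' : nat) (x : state S), (0 < N')%N -> Xbox x ->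
     (Vfin N' x <= (gamma * ((scost S)^T *m x) 0 0)%:E)%E)
  (N : nat) (hN0 : (0 < N)%N)
  (hN : N%:R > 2 + ln (gamma - 1) / (ln gamma - ln (gamma - 1)))
  (ustar : state S -> nat -> input S)
  (hustar : forall x : state S, Xbox x -> optimal N x (ustar x))
  (mu : state S -> input S)
  (hmu : forall x : state S, Xbox x -> mu x = ustar x 0%N) :
  gas mu /\
  (0 < alphaN gamma N < 1) /\
  (forall x0 : state S, Xbox x0 ->
     (Jcl x0 mu <= Vinf x0 / (alphaN gamma N)%:E)%E).
Proof.
have gap : (gamma - 1) ^+ N < gamma ^+ N.-1 - (gamma - 1) ^+ N.-1.
  exact: geometric_gap_of_horizon.
have a01 := alphaN_itv hgamma gap.
pose W x := Jfin N x (ustar x).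
have step_X x : Xbox x -> Xbox (step x (mu x)).
  move=> xX; rewrite hmu//.
  have := (hustar x xX).1; rewrite -(subnKC hN0) => /Ufin_take[_].
  exact.
have mu0 x : Xbox x -> forall k, 0 <= mu x k 0.
  by move=> xX; rewrite hmu//; exact: Ufin_input_ge0 (hustar x xX).1 hN0.
have W_lb x : Xbox x -> ((scost S)^T *m x) 0 0 <= W x.
  move=> xX; have uX := (hustar x xX).1.
  apply: le_trans (scost_le_stage_cost x (mu0 x xX)) _; rewrite hmu// /W.
  move: uX; rewrite -(prednK hN0) Jfin_succ lerDl => uX.
  exact: Jfin_ge0 (@Ufin_drop _ _ 1 _ _ _ uX).
have W_ub x : Xbox x -> W x <= gamma * ((scost S)^T *m x) 0 0.
  by move=> xX; rewrite -lee_fin (hustar x xX).2 hV.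
have W_step x : Xbox x ->
    W (step x (mu x)) <= W x - alphaN gamma N * stage_cost x (mu x).
  move=> xX; have := step_X x xX; rewrite hmu// => yX.
  exact: relaxed_Lyapunov_decrease (hustar x xX) (hustar _ yX).
split; last split=> [//|x xX].
- have /andP[a0 a1] := a01.
  have g0 : 0 < gamma by rewrite (lt_trans ltr01).
  set s1 := \sum_i (scost S i 0)^-1; set s2 := \sum_i scost S i 0.
  have s10 : 0 <= s1 by apply: sumr_ge0 => i _; rewrite invr_ge0 ltW// scost_gt0.
  have s20 : 0 <= s2 by apply: sumr_ge0 => i _; rewrite ltW// scost_gt0.
  have k0 : 0 < 1 - alphaN gamma N / gamma.
    by rewrite subr_gt0 ltr_pdivrMr// mul1r (lt_trans a1).
  (* [s1 * s2] vanishes on a network without vertices; the summand 1 keeps the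
     gain positive. *)
  apply: (@gas_of_exponential_bound _ _ _ (s1 * gamma * s2 + 1)
           (1 - alphaN gamma N / gamma)).
  + by rewrite ltr_wpDl// !mulr_ge0// ltW.
  + by rewrite k0 gtrBl divr_gt0.
  move=> x t xX.
  have yX := cl_traj_Xbox step_X t xX.
  apply: le_trans (enorm_le_scost yX) _.
  have decay := scost_cl_traj_le a01 hgamma step_X mu0 W_lb W_ub W_step t xX.
  apply: le_trans (ler_wpM2l s10 decay) _.
  set k := _ ^+ t.
  have k0' : 0 <= k by rewrite exprn_ge0// ltW.
  have := ler_wpM2l (mulr_ge0 (mulr_ge0 s10 (ltW g0)) k0') (scost_le_enorm xX).
  rewrite -/s1 -/s2 => H.
  have : 0 <= enorm x * k by rewrite mulr_ge0// sqrtr_ge0.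
  by move: H; lra.
- have /andP[a0 _] := a01.
  apply: le_trans (Jcl_le a01 step_X mu0 W_lb W_step xX) _.
  rewrite inver gt_eqF// EFinM lee_pmul2r ?lte_fin ?invr_gt0// ?fin_numE//.
  exact: optimal_le_Vinf (hustar x xX).
Qed.
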